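(* Let $n\ge 2w\ge 2$ and $e\ge 2$ be integers. If a nontrivial $e$-perfect code exists in $J(n,w)$ and $p$ is a prime with $e<p\le \frac{4e+2}{3}$, then $p$ divides $\Phi_e(n,w)=\sum_{i=0}^{e}\binom{w}{i}\binom{n-w}{i}$.
   Context: The Johnson scheme $J(n,w)$ has as elements all $w$-subsets of $[n]=\{1,\dots,n\}$, with distance $d(X,Y)=|X\setminus Y|$. The $e$-ball centred at $X$ is the set of $w$-subsets at distance at most $e$ from $X$. An $e$-perfect code in $J(n,w)$ is a set $\mathcal C$ of $w$-subsets such that the $e$-balls centred at the elements of $\mathcal C$ partition the set of all $w$-subsets of $[n]$. It is trivial if $e=0$, or $|\mathcal C|=1$, or $n=2w$, $w=2e+1$ and $\mathcal C$ consists of a $w$-subset and its complement; otherwise it is nontrivial. *)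

(* Defs.v *)
From mathcomp Require Import all_boot.

Set Implicit Arguments.
Unset Strict Implicit.
Unset Printing Implicit Defensive.

(* The ground set [n] = {1, ..., n} is represented by 'I_n = {0, ..., n-1}. *)

Definition johnson (n w : nat) : {set {set 'I_n}} :=
  [set X : {set 'I_n} | #|X| == w].

Definition jdist (n : nat) (X Y : {set 'I_n}) : nat := #|X :\: Y|.

Definition jball (n w e : nat) (X : {set 'I_n}) : {set {set 'I_n}} :=
  [set Y in johnson n w | jdist X Y <= e].

(* The balls partition J(n, w) as a family indexed by the centres: distinct
   centres must have disjoint balls.  The library's [partition], applied to the
   set of balls, would identify distinct centres having the same ball. *)
Definition perfect_code (n w e : nat) (C : {set {set 'I_n}}) : Prop :=
  [/\ C \subset johnson n w,
      {in C &, forall X Y, X != Y -> [disjoint jball w e X & jball w e Y]}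
    & \bigcup_(X in C) jball w e X = johnson n w].

Definition trivial_code (n w e : nat) (C : {set {set 'I_n}}) : Prop :=
  [\/ e = 0,
      #|C| = 1
    | [/\ n = 2 * w, w = 2 * e + 1
        & exists2 X, X \in johnson n w & C = [set X; ~: X]]].

Definition Phi (e n w : nat) : nat :=
  \sum_(0 <= i < e.+1) 'C(w, i) * 'C(n - w, i).

(* Main.v *)
Require Import Defs.
From mathcomp Require Import all_boot.
From mathcomp Require Import zify.

Set Implicit Arguments.
Unset Strict Implicit.
Unset Printing Implicit Defensive.

(** The theorem is a congruence for block designs.  Take two codewords of a
    nontrivial perfect code; disjointness of their balls puts them at distance
    at least [2 * e + 1], whence [2 * e + 1 <= w <= n - w].

    Fix a codeword [X] and let [A], [B] be [e.+1]-subsets of [X] and of its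
    complement.  Exchanging [A] for [B] in [X] gives a word at distance
    [e.+1] from [X]; the codeword [Z] whose ball covers it is not [X], is
    therefore at distance exactly [2 * e + 1] from [X], removes all of [A] and
    adds all of [B], and it is the only such codeword
    ([perfect_code_exchange]).  With [B] fixed, the sets [X :\: Z] are thus the
    blocks of a Steiner system S(e+1, 2e+1) on [X]; with [A] fixed, the sets
    [Z :\: X] are the blocks of one on the complement of [X].

    In a Steiner system S(e+1, 2e+1) on [v] points, count the blocks through
    [s := 2 * e + 1 - p] given points: [C(2e+1-s, e+1-s) = C(p, p-e)] divides
    [C(v-s, p-e)] ([steiner_dvd_bin]).  The former is a multiple of [p], so one
    of the [p - e] consecutive integers [v-s], ..., [v-e] is, and [v] is
    congruent modulo [p] to some [r] with [s <= r <= e] ([steiner_residue]).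

    Let [a] and [b] be these residues for [w] and [n - w].  As [e < p], the
    binomials in [Phi e n w] depend only on [a] and [b] modulo [p], and
    Vandermonde's identity gives [Phi e n w = C(a+b, a)] modulo [p]; the sum is
    not truncated, because [a <= e].  Finally [a, b < p], while
    [a + b >= 2 * (2 * e + 1 - p) >= p] is exactly the assumption
    [3 * p <= 4 * e + 2], so that [p] divides [C(a+b, a)]. *)

(** * Binomial coefficients modulo a prime *)

Lemma bin_mod_prime p m i :
  prime p -> i < p -> 'C(m, i) = 'C(m %% p, i) %[mod p].
Proof.
move=> p_pr lt_ip; rewrite {1}(divn_eq m p).
elim: (m %/ p) => [|q IHq]; first by rewrite mul0n.
rewrite mulSn -addnA -Vandermonde big_ord_recl bin0 mul1n subn0 -modnDmr.
suff /eqP->: p %| \sum_(j < i) 'C(p, lift ord0 j) *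
                   'C(q * p + m %% p, i - lift ord0 j) by rewrite addn0 IHq.
apply: dvdn_sum => j _; apply/dvdn_mulr/prime_dvd_bin => //.
by rewrite lift0 /= (leq_ltn_trans (ltn_ord j)).
Qed.

Lemma prime_dvd_fact p m : prime p -> (p %| m`!) = (p <= m).
Proof.
move=> p_pr; apply/idP/idP => [|le_pm]; last first.
  by rewrite dvdn_fact // prime_gt0.
elim: m => [|m IHm]; first by rewrite fact0 Euclid_dvd1.
by rewrite factS Euclid_dvdM // => /orP[/dvdn_leq -> // | /IHm /leqW].
Qed.

(** In [(a + b)! = C(a + b, a) * a! * b!], the left-hand side is divisible by
    [p] while the two factorials on the right are not. *)
Lemma prime_dvd_binD p a b :
  prime p -> a < p -> b < p -> p <= a + b -> p %| 'C(a + b, a).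
Proof.
move=> p_pr lt_ap lt_bp le_pab.
have: p %| (a + b)`! by rewrite prime_dvd_fact.
rewrite -(bin_fact (leq_addr b a)) addKn !Euclid_dvdM // !prime_dvd_fact //.
by rewrite [p <= a]leqNgt [p <= b]leqNgt lt_ap lt_bp !orbF.
Qed.

Lemma prime_dvd_bin_factor p m k :
  prime p -> p %| 'C(m, k) -> exists2 j, j < k & p %| m - j.
Proof.
move=> p_pr /(dvdn_mulr k`!); rewrite bin_ffact ffact_prod Euclid_dvd_prod //.
by rewrite big_has => /hasP[j _ pj]; exists (j : nat).
Qed.

Lemma sum_bin_mul a b e :
  a <= e -> \sum_(0 <= i < e.+1) 'C(a, i) * 'C(b, i) = 'C(a + b, a).
Proof.
move=> le_ae; rewrite (big_cat_nat _ (n := a.+1)) //=.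
rewrite [X in _ + X]big_nat_cond [X in _ + X]big1 ?addn0; last first.
  by move=> i; rewrite andbT => /andP[lt_ai _]; rewrite bin_small.
rewrite addnC -Vandermonde big_mkord; apply: eq_bigr => i _.
by rewrite mulnC bin_sub // -ltnS.
Qed.

(** * Steiner systems *)

Section Steiner.

Variable T : finType.
Implicit Types (U I A : {set T}) (F : {set {set T}}).

Lemma exists_subset_card U k :
  k <= #|U| -> exists2 A : {set T}, A \subset U & #|A| = k.
Proof.
rewrite -bin_gt0 -cards_draws => /card_gt0P[A].
by rewrite inE => /andP[sAU /eqP]; exists A.
Qed.

Lemma card_subsets_above I U k : I \subset U -> #|I| <= k ->
  #|[set A : {set T} | [&& I \subset A, A \subset U & #|A| == k]]|
    = 'C(#|U| - #|I|, k - #|I|).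
Proof.
move=> sIU leIk; rewrite -[#|U| - _](cardsDS sIU) -cards_draws.
rewrite -(@card_in_imset _ _ (fun A => A :\: I)); last first.
  move=> A B; rewrite !inE => /and3P[sIA _ _] /and3P[sIB _ _] eqD.
  by rewrite -(setID A I) -(setID B I) eqD (setIidPr sIA) (setIidPr sIB).
apply: eq_card => B; rewrite inE; apply/imsetP/andP=> [[A] | [sBU /eqP cB]].
  rewrite inE => /and3P[sIA sAU /eqP cA] ->.
  by rewrite setSD // cardsDS // cA.
have dBI: B :&: I = set0.
  by apply/eqP; rewrite setI_eq0; case/subsetDP: sBU.
exists (B :|: I); last by rewrite setDUl setDv setU0 (setDidPl _) // -setI_eq0 dBI.
rewrite inE subsetUr subUset sIU (subset_trans sBU) ?subsetDl //=.
by have := cardsUI B I; rewrite dBI cards0 cB; lia.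
Qed.

(** The usual S(t, k, #|U|), with the point set [U] a subset of the ambient
    type so that it can be a codeword or its complement. *)
Definition steiner t k U F :=
  {in F, forall b : {set T}, b \subset U /\ #|b| = k} /\
  (forall A : {set T}, A \subset U -> #|A| = t -> #|[set b in F | A \subset b]| = 1).

(** Double counting of the [t]-sets [A] with [I \subset A \subset U] by the
    block that contains them: every block through [I] accounts for
    ['C(k - #|I|, t - #|I|)] of them. *)
Lemma steiner_dvd_bin t k U F I :
    steiner t k U F -> I \subset U -> #|I| <= t ->
  'C(k - #|I|, t - #|I|) %| 'C(#|U| - #|I|, t - #|I|).
Proof.
move=> [blockF uniqF] sIU leIt.
rewrite -(card_subsets_above sIU leIt) -sum1dep_card.
rewrite (eq_bigr (fun A => \sum_(b in F | A \subset b) 1)); last first.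
  move=> A /and3P[_ sAU /eqP cA].
  by rewrite -[LHS](uniqF A sAU cA) -sum1dep_card.
rewrite (exchange_big_dep [in F]) /=; last by move=> A b _ /andP[].
apply: dvdn_sum => b Fb; have [sbU cb] := blockF b Fb.
have [sIb | nsIb] := boolP (I \subset b); last first.
  rewrite big1 // => A /andP[/and3P[sIA _ _] /andP[_ sAb]].
  by rewrite (subset_trans sIA sAb) in nsIb.
rewrite -cb -(card_subsets_above sIb leIt) -sum1dep_card.
rewrite [X in _ %| X](eq_bigl (fun A => [&& I \subset A, A \subset b
                                         & #|A| == t])) //.
move=> A; rewrite Fb /=; case: (boolP (A \subset b)) => sAb /=.
  by rewrite andbT (subset_trans sAb sbU).
by rewrite !andbF.
Qed.

(** Counting blocks through [2 * e + 1 - p] points shows that a product of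
    [p - e] consecutive integers, from [#|U| - (2 * e + 1 - p)] down to
    [#|U| - e], is a multiple of [p]; the factor that [p] divides gives the
    residue. *)
Lemma steiner_residue e p U F :
    steiner e.+1 (2 * e + 1) U F -> prime p -> e < p <= 2 * e + 1 ->
    2 * e + 1 <= #|U| ->
  2 * e + 1 - p <= #|U| %% p <= e.
Proof.
move=> stF p_pr /andP[lt_ep le_p] leU.
(* Through this many points the derived system has blocks of size [p]. *)
pose s := 2 * e + 1 - p.
have [|I sIU cI] := @exists_subset_card U s; first by rewrite /s; lia.
have := steiner_dvd_bin stF sIU; rewrite cI => /(_ ltac:(rewrite /s; lia)).
have -> : 2 * e + 1 - s = p by rewrite /s; lia.
have -> : e.+1 - s = p - e by rewrite /s; lia.
have p_dvd: p %| 'C(p, p - e).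
  by apply: prime_dvd_bin => //; have := prime_gt1 p_pr; lia.
move/(dvdn_trans p_dvd)/(prime_dvd_bin_factor p_pr) => [j lt_j].
move/dvdnP=> [q Uq].
have -> : #|U| = q * p + (s + j) by rewrite /s in Uq *; lia.
by rewrite modnMDl modn_small; rewrite /s; lia.
Qed.

End Steiner.

(** * Codewords around a given codeword *)

Section Exchange.

Variable n : nat.
Implicit Types (X Y Z A B : {set 'I_n}).

Definition exchange X A B := (X :\: A) :|: B.

Lemma jdist_sym X Y : #|X| = #|Y| -> jdist X Y = jdist Y X.
Proof. by rewrite /jdist !cardsD setIC => ->. Qed.

(** An additive form, to avoid truncated subtraction.  The particular cases
    [Z := set0] and [Z := X] give the size of the exchanged word and its
    distance to [X]. *)
Lemma jdist_exchange X A B Z : A \subset X -> B \subset ~: X ->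
  jdist (exchange X A B) Z + jdist A Z = jdist X Z + jdist B Z.
Proof.
move=> sAX sBX; rewrite /jdist.
have sAZ : A :\: Z \subset X :\: Z by apply: setSD.
have -> : exchange X A B :\: Z = ((X :\: Z) :\: (A :\: Z)) :|: (B :\: Z).
  apply/setP=> x; rewrite !inE.
  by case: (x \in X); case: (x \in A); case: (x \in B); case: (x \in Z).
have dXB : ((X :\: Z) :\: (A :\: Z)) :&: (B :\: Z) = set0.
  apply/setP=> x; rewrite !inE; have /implyP := subsetP sBX x; rewrite inE.
  by case: (x \in X); case: (x \in A); case: (x \in B); case: (x \in Z).
have := cardsUI ((X :\: Z) :\: (A :\: Z)) (B :\: Z).
by rewrite dXB cards0 addn0 => ->; rewrite addnAC cardsDS // subnK ?subset_leq_card.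
Qed.

Lemma jdist_sub X Y : X \subset Y -> jdist X Y = 0.
Proof. by rewrite /jdist -setD_eq0 => /eqP->; rewrite cards0. Qed.

Lemma card_exchange X A B :
  A \subset X -> B \subset ~: X -> #|A| = #|B| -> #|exchange X A B| = #|X|.
Proof.
move=> sAX sBX eqAB; have := jdist_exchange set0 sAX sBX.
by rewrite /jdist !setD0 eqAB => /addIn.
Qed.

Lemma jdist_exchange_self X A B :
  A \subset X -> B \subset ~: X -> jdist (exchange X A B) X = #|B|.
Proof.
move=> sAX sBX; have := jdist_exchange X sAX sBX.
rewrite (jdist_sub sAX) (jdist_sub (subxx X)) addn0 add0n => ->.
by rewrite /jdist setDE (setIidPl sBX).
Qed.

Variables (w e : nat) (C : {set {set 'I_n}}).
Hypothesis perfectC : perfect_code w e C.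

Lemma card_codeword X : X \in C -> #|X| = w.
Proof. by case: perfectC => /subsetP sCJ _ _ /sCJ; rewrite inE => /eqP. Qed.

Lemma code_ball_inj X Z Y :
    X \in C -> Z \in C -> #|Y| = w -> jdist Y X <= e -> jdist Y Z <= e ->
  X = Z.
Proof.
move=> CX CZ cY dYX dYZ; apply: contraTeq isT => neXZ.
have [_ /(_ X Z CX CZ neXZ) /pred0P/(_ Y)/= + _] := perfectC.
rewrite !inE cY eqxx (jdist_sym (X := X)) ?(card_codeword CX) // dYX.
by rewrite jdist_sym ?(card_codeword CZ) // dYZ.
Qed.

Lemma code_cover Y : #|Y| = w -> exists2 Z, Z \in C & jdist Y Z <= e.
Proof.
move=> cY; have [_ _ cover] := perfectC.
have: Y \in johnson n w by rewrite inE cY.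
rewrite -cover => /bigcupP[Z CZ]; rewrite !inE => /andP[_ dZY].
by exists Z; rewrite // jdist_sym // (card_codeword CZ).
Qed.

(** Two codewords at distance at most [2 * e] would share a word of their
    balls, half-way between them. *)
Lemma code_min_dist X Z : X \in C -> Z \in C -> X != Z -> 2 * e < jdist X Z.
Proof.
move=> CX CZ; apply: contraNltn => le_d; apply/eqP.
have cXZ : #|X| = #|Z| by rewrite !card_codeword.
pose m := minn e (jdist X Z).
have [|A sA cA] := @exists_subset_card _ (X :\: Z) m; first exact: geq_minr.
have [|B sB cB] := @exists_subset_card _ (Z :\: X) m.
  by rewrite -/(jdist Z X) -jdist_sym // geq_minr.
have sAX : A \subset X := subset_trans sA (subsetDl _ _).
have sBX : B \subset ~: X by apply: subset_trans sB _; rewrite setDE subsetIr.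
have sBZ : B \subset Z := subset_trans sB (subsetDl _ _).
have dAZ : jdist A Z = m.
  by rewrite -cA /jdist; congr #|pred_of_set _|; apply/setDidPl; case/subsetDP: sA.
apply: (@code_ball_inj _ _ (exchange X A B)) => //.
- by rewrite card_exchange ?cA ?cB // card_codeword.
- by rewrite jdist_exchange_self // cB geq_minl.
have := jdist_exchange Z sAX sBX; rewrite dAZ (jdist_sub sBZ) /m; lia.
Qed.

(** No codeword other than [X] is closer to [X], by [code_min_dist]. *)
Definition nearest_codewords X := [set Z in C | jdist X Z == 2 * e + 1].

(** The codeword that covers [exchange X A B] has the required property, since
    the minimum distance forces equality in the triangle inequality through
    that word.  Conversely a codeword with this property is at distance [e]
    from [exchange X A B], so it is the one that covers it. *)
Lemma perfect_code_exchange X A B :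
    X \in C -> A \subset X -> B \subset ~: X -> #|A| = e.+1 -> #|B| = e.+1 ->
  exists Z, [set Z in nearest_codewords X | (A \subset X :\: Z)
                                            && (B \subset Z :\: X)] = [set Z].
Proof.
move=> CX sAX sBX cA cB; pose Y := exchange X A B.
have cY : #|Y| = w by rewrite card_exchange ?cA ?cB // card_codeword.
have [Z CZ dYZ] := code_cover cY; exists Z.
have dYX : jdist Y X = e.+1 by rewrite jdist_exchange_self.
have neXZ : X != Z by apply: contraTneq dYZ => <-; rewrite dYX ltnn.
have dXZ := code_min_dist CX CZ neXZ.
have dY := jdist_exchange Z sAX sBX; rewrite -/Y in dY.
have leAZ : jdist A Z <= #|A| := subset_leq_card (subsetDl A Z).
(* [dY] reads [jdist Y Z + jdist A Z = jdist X Z + jdist B Z], with left-hand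
   side at most [e + e.+1] and right-hand side at least [2 * e + 1]. *)
have dAZ : jdist A Z = #|A| by lia.
have dBZ : jdist B Z = 0 by lia.
have {}dXZ : jdist X Z = 2 * e + 1 by lia.
apply/setP=> Z'; rewrite !inE; apply/andP/eqP => [[] | ->]; last first.
  rewrite CZ dXZ eqxx !subsetD sAX; split=> //; apply/andP; split.
    by rewrite -setI_eq0 -cards_eq0; have := cardsID Z A; move: dAZ; rewrite /jdist; lia.
  rewrite -setD_eq0 -cards_eq0; move: dBZ; rewrite /jdist => -> /=.
  by rewrite disjoints_subset.
move=> /andP[CZ' /eqP dXZ'] /andP[sA sB].
apply: (code_ball_inj CZ' CZ cY _ dYZ).
have := jdist_exchange Z' sAX sBX; rewrite -/Y dXZ'.
rewrite (jdist_sub (subset_trans sB (subsetDl _ _))).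
suff -> : jdist A Z' = #|A| by lia.
by congr #|pred_of_set _|; apply/setDidPl; case/subsetDP: sA.
Qed.

(** Together with [steiner_added], this is Etzion's observation that a perfect
    code yields Steiner systems on a codeword and on its complement: one of the
    two sets exchanged is kept fixed while the other one varies. *)
Lemma steiner_removed X B : X \in C -> B \subset ~: X -> #|B| = e.+1 ->
  steiner e.+1 (2 * e + 1) X
    [set X :\: Z | Z in nearest_codewords X & B \subset Z :\: X].
Proof.
move=> CX sBX cB; split=> [b /imsetP[Z] | A sAX cA].
  by rewrite !inE => /andP[/andP[_ /eqP dXZ] _] ->; rewrite subsetDl.
have [Z defZ] := perfect_code_exchange CX sAX sBX cA cB.
rewrite -[RHS](cards1 (X :\: Z)) -(imset_set1 (setD X)) -defZ.
apply: eq_card => b; rewrite inE.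
apply/andP/imsetP => [[/imsetP[Z'] + ->] | [Z' + ->]]; rewrite !inE.
  by move=> /andP[NZ' sB] sA; exists Z'; rewrite // !inE NZ' sA.
by move=> /and3P[NZ' sA sB]; split; first by apply: imset_f; rewrite !inE NZ'.
Qed.

Lemma steiner_added X A : X \in C -> A \subset X -> #|A| = e.+1 ->
  steiner e.+1 (2 * e + 1) (~: X)
    [set Z :\: X | Z in nearest_codewords X & A \subset X :\: Z].
Proof.
move=> CX sAX cA; split=> [b /imsetP[Z] | B sBX cB].
  rewrite !inE => /andP[/andP[CZ /eqP dXZ] _] ->; rewrite subsetDr.
  by rewrite -/(jdist Z X) jdist_sym ?card_codeword.
have [Z defZ] := perfect_code_exchange CX sAX sBX cA cB.
rewrite -[RHS](cards1 (Z :\: X)) -(imset_set1 (fun Y : {set 'I_n} => Y :\: X)) -defZ.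
apply: eq_card => b; rewrite inE.
apply/andP/imsetP => [[/imsetP[Z'] + ->] | [Z' + ->]]; rewrite !inE.
  by move=> /andP[NZ' sA] sB; exists Z'; rewrite // !inE NZ' sA.
by move=> /and3P[NZ' sA sB]; split; first by apply: imset_f; rewrite !inE NZ'.
Qed.

End Exchange.

(** * The divisibility of the ball size *)

Theorem corollary5p1 (n w e p : nat) (hw : 2 <= 2 * w) (hn : 2 * w <= n)
    (he : 2 <= e)
    (hC : exists C : {set {set 'I_n}},
        perfect_code w e C /\ ~ trivial_code w e C)
    (hp : prime p) (hep : e < p) (hpe : 3 * p <= 4 * e + 2) :
  p %| Phi e n w.
Proof.
have [C [perfC ntC]] := hC.
have [Y0 _ cY0] : exists2 Y0 : {set 'I_n}, Y0 \subset setT & #|Y0| = w.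
  by apply: exists_subset_card; rewrite cardsT card_ord; lia.
have [X CX _] := code_cover perfC cY0.
have [Z CZ neXZ] : exists2 Z, Z \in C & X != Z.
  apply/exists_inP; apply: contra_notT ntC => /exists_inPn noZ.
  apply: Or32; rewrite (_ : C = [set X]) ?cards1 //.
  apply/setP=> Z; rewrite inE; apply/idP/eqP => [CZ | -> //].
  by have := noZ Z CZ; rewrite negbK => /eqP.
have cX := card_codeword perfC CX.
have lt_ew : 2 * e < w.
  rewrite (leq_trans (code_min_dist perfC CX CZ neXZ)) // -cX.
  exact/subset_leq_card/subsetDl.
have cXC : #|~: X| = n - w by have := cardsC X; rewrite card_ord; lia.
have [|A sAX cA] := @exists_subset_card _ X e.+1; first by lia.
have [|B sBX cB] := @exists_subset_card _ (~: X) e.+1; first by lia.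
have le_p : e < p <= 2 * e + 1 by lia.
have := steiner_residue (steiner_removed perfC CX sBX cB) hp le_p.
have := steiner_residue (steiner_added perfC CX sAX cA) hp le_p.
rewrite cX cXC => /(_ ltac:(lia)) /andP[ge_b le_b] /(_ ltac:(lia)) /andP[ge_a le_a].
have PhiE : Phi e n w = 'C(w %% p + (n - w) %% p, w %% p) %[mod p].
  rewrite -(sum_bin_mul _ le_a) /Phi !big_mkord -modn_summ -[RHS]modn_summ.
  congr (_ %% _); apply: eq_bigr => i _.
  have lt_ip : i < p := leq_trans (ltn_ord i) hep.
  by rewrite -modnMm (bin_mod_prime w) // (bin_mod_prime (n - w)) // modnMm.
by rewrite /dvdn PhiE; apply: prime_dvd_binD; rewrite ?ltn_pmod ?prime_gt0 //; lia.
Qed.
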